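(* Let $\Lambda\geq 0$. Let $F(z)=\bar{z}G(z)+H(z)$, $z\in\mathbb{D}$, where $G$ and $H$ are analytic in $\mathbb{D}$ with $G(0)=0$, $H(0)=0$, $H'(0)=1$, $|G'(z)|\leq\Lambda$ for all $z\in\mathbb{D}$, and either $|H(z)|<1$ for all $z\in\mathbb{D}$ or $|H'(z)|\leq 1$ for all $z\in\mathbb{D}$. Define $\rho_2=1$ if $0\leq\Lambda\leq 1/2$ and $\rho_2=\frac{1}{2\Lambda}$ if $\Lambda>1/2$, and $\sigma_2=\rho_2-\Lambda\rho_2^2$. Then $F$ is univalent in $\mathbb{D}_{\rho_2}$ and $F(\mathbb{D}_{\rho_2})\supseteq\mathbb{D}_{\sigma_2}$. This result is sharp (the constants $\rho_2$ and $\sigma_2$ cannot be replaced by larger ones), as shown by the function $F_2(z)=\Lambda|z|^2+z$.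
   Context: $\mathbb{D}=\{z:|z|<1\}$ and $\mathbb{D}_r=\{z\in\mathbb{C}:|z|<r\}$. *)

(* Defs.v *)
From Stdlib Require Import Reals.
From Coquelicot Require Import Coquelicot.
Open Scope R_scope.

Definition in_disc (r : R) (z : C) : Prop := Cmod z < r.

Definition analytic_on_unit_disc (f : C -> C) : Prop :=
  forall z : C, in_disc 1 z -> ex_derive f z.

Definition univalent_on_disc (f : C -> C) (r : R) : Prop :=
  forall z w : C, in_disc r z -> in_disc r w -> f z = f w -> z = w.

Definition image_contains_disc (f : C -> C) (r s : R) : Prop :=
  forall w : C, in_disc s w -> exists z : C, in_disc r z /\ f z = w.

Definition rho2 (Lam : R) : R := if Rle_dec Lam (1/2) then 1 else 1 / (2 * Lam).
Definition sigma2 (Lam : R) : R := rho2 Lam - Lam * (rho2 Lam)^2.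

Definition F2 (Lam : R) (z : C) : C := Cplus (RtoC (Lam * (Cmod z)^2)) z.

(* Main.v *)
Require Import Defs.
From Stdlib Require Import Reals Lra Lia ClassicalEpsilon.
From Coquelicot Require Import Coquelicot.
Open Scope R_scope.

(** The hypotheses force [H z = z]: if [|H'| <= 1] then [|H z| <= |z|] by the mean
    value inequality, so in both cases [|H| < 1], and the equality case of the Schwarz
    lemma applies. Then [F z = z + conj z * G z] with [G] Lipschitz of constant [Lam],
    so [conj z * G z] has Lipschitz constant at most [2 * Lam * r] on the disc of
    radius [r], which is less than [1] for [r < rho2]: this gives injectivity, and
    every [w] with [|w| <= r - Lam * r^2] is reached by the Banach fixed point of
    [z |-> w - conj z * G z].

    Rigidity in the Schwarz lemma is obtained from circle means only. By Goursat's
    theorem for rectangles in polar coordinates, the mean of [k] over [|z| = r] does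
    not depend on [r] if [k] is differentiable, up to one point where it is continuous.
    For [g z = H z / z] the mean is [1], whence the mean of [|H z - z|^2] is at most
    [1 - r^2], which tends to [0] as [r -> 1]. With [phi z = H z - z], the function
    [z * (phi z - phi z0) / (z - z0)] has mean [0], which bounds [|phi z0|] by a
    multiple of the mean of [|phi|]. *)

(** * Goursat's theorem for rectangles *)

(** Left ends increase and right ends [x n + w / 2 ^ n] decrease, so the supremum of the left ends
    lies in every interval. *)
Lemma nested_halving_intervals (w : R) (x : nat -> R) :
  0 < w ->
  (forall n, x n <= x (S n) <= x n + w / 2 ^ S n) ->
  exists l, forall n, x n <= l <= x n + w / 2 ^ n.
Proof.
  intros Hw Hx.
  assert (Hpow : forall n, 0 < 2 ^ n) by (intros n; apply pow_lt; lra).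
  assert (Hhalf : forall n, w / 2 ^ n = 2 * (w / 2 ^ S n)).
  { intros n; simpl; field; pose proof (Hpow n); lra. }
  assert (Hpos : forall n, 0 < w / 2 ^ n).
  { intros n; apply Rdiv_lt_0_compat; auto. }
  assert (Hinc : forall n k, x n <= x (n + k)%nat).
  { intros n k; induction k as [|k IH].
    - rewrite Nat.add_0_r; lra.
    - rewrite Nat.add_succ_r; specialize (Hx (n + k)%nat); lra. }
  assert (Hdec : forall n k, x (n + k)%nat + w / 2 ^ (n + k) <= x n + w / 2 ^ n).
  { intros n k; induction k as [|k IH].
    - rewrite Nat.add_0_r; lra.
    - rewrite Nat.add_succ_r; specialize (Hx (n + k)%nat).
      pose proof (Hhalf (n + k)%nat); lra. }
  assert (Hub : forall n m, x m <= x n + w / 2 ^ n).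
  { intros n m; destruct (Nat.le_ge_cases n m) as [Hnm|Hnm].
    - replace m with (n + (m - n))%nat by lia.
      pose proof (Hdec n (m - n)%nat); pose proof (Hpos (n + (m - n))%nat); lra.
    - pose proof (Hinc m (n - m)%nat) as HI.
      replace (m + (n - m))%nat with n in HI by lia.
      pose proof (Hpos n); lra. }
  destruct (completeness (fun r => exists n, r = x n)) as [l [Hl1 Hl2]].
  - exists (x 0%nat + w / 2 ^ 0); intros r [n ->]; apply Hub.
  - exists (x 0%nat), 0%nat; reflexivity.
  - exists l; intros n; split.
    + apply Hl1; exists n; reflexivity.
    + apply Hl2; intros r [m ->]; apply Hub.
Qed.

Lemma rectangle_bisection (w h a c : R) (Bad : R -> R -> nat -> Prop) :
  0 < w -> 0 < h -> Bad a c 0%nat ->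
  (forall x y n, Bad x y n -> exists x' y',
     x <= x' <= x + w / 2 ^ S n /\ y <= y' <= y + h / 2 ^ S n /\ Bad x' y' (S n)) ->
  exists p q, forall n, exists x y,
    x <= p <= x + w / 2 ^ n /\ y <= q <= y + h / 2 ^ n /\ Bad x y n.
Proof.
  intros Hw Hh H0 Hstep.
  (* The hypothesis [Bad] sits under the existential so that choice yields a total successor [next];
     its value at corners that are not bad is arbitrary. *)
  assert (Hchoice : forall (s : R * R) n, exists s' : R * R,
    Bad (fst s) (snd s) n ->
    fst s <= fst s' <= fst s + w / 2 ^ S n /\
    snd s <= snd s' <= snd s + h / 2 ^ S n /\ Bad (fst s') (snd s') (S n)).
  { intros s n; destruct (excluded_middle_informative (Bad (fst s) (snd s) n)) as [B|B].
    - destruct (Hstep _ _ _ B) as [x' [y' Hxy]]; exists (x', y'); intros _; exact Hxy.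
    - exists s; intros B'; contradiction. }
  pose (next s n := proj1_sig (constructive_indefinite_description _ (Hchoice s n))).
  pose (seq := fix seq n := match n with O => (a, c) | S k => next (seq k) k end).
  assert (Hnext : forall s n, Bad (fst s) (snd s) n ->
    fst s <= fst (next s n) <= fst s + w / 2 ^ S n /\
    snd s <= snd (next s n) <= snd s + h / 2 ^ S n /\
    Bad (fst (next s n)) (snd (next s n)) (S n)).
  { intros s n; unfold next.
    destruct (constructive_indefinite_description _ _) as [s' Hs']; exact Hs'. }
  assert (Hbad : forall n, Bad (fst (seq n)) (snd (seq n)) n).
  { intros n; induction n as [|n IH]; [exact H0|]; apply (Hnext _ _ IH). }
  destruct (nested_halving_intervals w (fun n => fst (seq n)) Hw) as [p Hp].
  { intros n; apply (Hnext _ _ (Hbad n)). }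
  destruct (nested_halving_intervals h (fun n => snd (seq n)) Hh) as [q Hq].
  { intros n; apply (Hnext _ _ (Hbad n)). }
  exists p, q; intros n; exists (fst (seq n)), (snd (seq n)).
  split; [apply Hp | split; [apply Hq | apply Hbad]].
Qed.

(** The counterclockwise line integral of the form [P dx + Q dy]. *)
Definition boundary_integral (P Q : R -> R -> R) (x1 x2 y1 y2 : R) : R :=
  RInt (fun x => P x y1) x1 x2 + RInt (fun y => Q x2 y) y1 y2
  - RInt (fun x => P x y2) x1 x2 - RInt (fun y => Q x1 y) y1 y2.

Lemma continuity_2d_pt_1 (f : R -> R -> R) (x y : R) :
  continuity_2d_pt f x y -> continuous (fun u => f u y) x.
Proof.
  intros Hf; apply continuity_pt_filterlim.
  intros eps Heps; destruct (Hf (mkposreal eps Heps)) as [d Hd].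
  exists d; split; [apply cond_pos|].
  intros u [_ Hu]; apply Hd; [exact Hu|].
  rewrite Rminus_diag; rewrite Rabs_R0; apply cond_pos.
Qed.

Lemma continuity_2d_pt_2 (f : R -> R -> R) (x y : R) :
  continuity_2d_pt f x y -> continuous (fun v => f x v) y.
Proof.
  intros Hf; apply continuity_pt_filterlim.
  intros eps Heps; destruct (Hf (mkposreal eps Heps)) as [d Hd].
  exists d; split; [apply cond_pos|].
  intros u [_ Hu]; apply Hd; [|exact Hu].
  rewrite Rminus_diag; rewrite Rabs_R0; apply cond_pos.
Qed.

Lemma ex_RInt_row (f : R -> R -> R) (x1 x2 y : R) :
  x1 <= x2 -> (forall x, x1 <= x <= x2 -> continuity_2d_pt f x y) ->
  ex_RInt (fun x => f x y) x1 x2.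
Proof.
  intros Hx Hf; apply (ex_RInt_continuous (V := R_CompleteNormedModule)).
  rewrite Rmin_left, Rmax_right by exact Hx.
  intros x Hx'; apply continuity_2d_pt_1, Hf, Hx'.
Qed.

Lemma ex_RInt_column (f : R -> R -> R) (x y1 y2 : R) :
  y1 <= y2 -> (forall y, y1 <= y <= y2 -> continuity_2d_pt f x y) ->
  ex_RInt (fun y => f x y) y1 y2.
Proof.
  intros Hy Hf; apply (ex_RInt_continuous (V := R_CompleteNormedModule)).
  rewrite Rmin_left, Rmax_right by exact Hy.
  intros y Hy'; apply continuity_2d_pt_2, Hf, Hy'.
Qed.

(** Each inner edge is run through twice, in opposite directions, and cancels. *)
Lemma boundary_integral_split (P Q : R -> R -> R) (x1 x2 x3 y1 y2 y3 : R) :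
  x1 <= x2 <= x3 -> y1 <= y2 <= y3 ->
  (forall x y, x1 <= x <= x3 -> y1 <= y <= y3 ->
     continuity_2d_pt P x y /\ continuity_2d_pt Q x y) ->
  boundary_integral P Q x1 x3 y1 y3 =
    boundary_integral P Q x1 x2 y1 y2 + boundary_integral P Q x2 x3 y1 y2
    + boundary_integral P Q x1 x2 y2 y3 + boundary_integral P Q x2 x3 y2 y3.
Proof.
  intros Hx Hy HC.
  assert (HP : forall y, y1 <= y <= y3 ->
    RInt (fun x => P x y) x1 x3 = RInt (fun x => P x y) x1 x2 + RInt (fun x => P x y) x2 x3).
  { intros y Hy'; symmetry.
    apply (RInt_Chasles (V := R_CompleteNormedModule) (fun x => P x y));
      apply ex_RInt_row; try lra; intros x Hx'; apply HC; lra. }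
  assert (HQ : forall x, x1 <= x <= x3 ->
    RInt (fun y => Q x y) y1 y3 = RInt (fun y => Q x y) y1 y2 + RInt (fun y => Q x y) y2 y3).
  { intros x Hx'; symmetry.
    apply (RInt_Chasles (V := R_CompleteNormedModule) (fun y => Q x y));
      apply ex_RInt_column; try lra; intros y Hy'; apply HC; lra. }
  unfold boundary_integral.
  rewrite (HP y1), (HP y3), (HQ x1), (HQ x3) by lra; ring.
Qed.

(** Serves to compare opposite sides of a small rectangle, and later integrals over circles. *)
Lemma RInt_difference_near_const (f g : R -> R) (a b k e : R) :
  a <= b -> ex_RInt f a b -> ex_RInt g a b ->
  (forall t, a <= t <= b -> Rabs (f t - g t - k) <= e) ->
  Rabs (RInt f a b - RInt g a b - (b - a) * k) <= (b - a) * e.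
Proof.
  intros Hab Hf Hg He.
  assert (Hfg : is_RInt (fun t => f t - g t - k) a b
                        (RInt f a b - RInt g a b - (b - a) * k)).
  { apply (is_RInt_minus (V := R_NormedModule)).
    - apply (is_RInt_minus (V := R_NormedModule));
        apply (RInt_correct (V := R_CompleteNormedModule)); assumption.
    - apply (is_RInt_const (V := R_NormedModule)). }
  rewrite <- (is_RInt_unique _ _ _ _ Hfg).
  apply abs_RInt_le_const; [exact Hab | eexists; exact Hfg | exact He].
Qed.

(* The closed affine parts contribute [- k * u * v] and [+ k * u * v], which cancel. *)
Lemma boundary_integral_small (P Q : R -> R -> R) (x y u v p q px k qy e : R) :
  0 <= u -> 0 <= v -> x <= p <= x + u -> y <= q <= y + v ->
  (forall s t, x <= s <= x + u -> y <= t <= y + v ->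
     continuity_2d_pt P s t /\ continuity_2d_pt Q s t /\
     Rabs (P s t - P p q - (px * (s - p) + k * (t - q))) <= e /\
     Rabs (Q s t - Q p q - (k * (s - p) + qy * (t - q))) <= e) ->
  Rabs (boundary_integral P Q x (x + u) y (y + v)) <= 2 * e * (u + v).
Proof.
  intros Hu Hv Hp Hq HPQ.
  assert (H1 : Rabs (RInt (fun s => P s y) x (x + u) - RInt (fun s => P s (y + v)) x (x + u)
     - (x + u - x) * (- (k * v))) <= (x + u - x) * (2 * e)).
  { apply RInt_difference_near_const; try lra.
    - apply ex_RInt_row; [lra|]; intros s Hs; apply HPQ; lra.
    - apply ex_RInt_row; [lra|]; intros s Hs; apply HPQ; lra.
    - intros s Hs.
      destruct (HPQ s y) as [_ [_ [A _]]]; try lra.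
      destruct (HPQ s (y + v)) as [_ [_ [B _]]]; try lra.
      apply Rabs_le_between in A; apply Rabs_le_between in B; apply Rabs_le_between; lra. }
  assert (H2 : Rabs (RInt (fun t => Q (x + u) t) y (y + v) - RInt (fun t => Q x t) y (y + v)
     - (y + v - y) * (k * u)) <= (y + v - y) * (2 * e)).
  { apply RInt_difference_near_const; try lra.
    - apply ex_RInt_column; [lra|]; intros s Hs; apply HPQ; lra.
    - apply ex_RInt_column; [lra|]; intros s Hs; apply HPQ; lra.
    - intros s Hs.
      destruct (HPQ x s) as [_ [_ [_ A]]]; try lra.
      destruct (HPQ (x + u) s) as [_ [_ [_ B]]]; try lra.
      apply Rabs_le_between in A; apply Rabs_le_between in B; apply Rabs_le_between; lra. }
  unfold boundary_integral.
  apply Rabs_le_between in H1; apply Rabs_le_between in H2; apply Rabs_le_between; lra.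
Qed.

(** The shared [k] says that [P dx + Q dy] is closed. Bisection keeps rectangles whose boundary
    integral is at least [E / 4 ^ n], whereas differentiability at their common point makes these
    integrals [o(4 ^ -n)]; hence [E = 0]. *)
Lemma goursat_rectangle (P Q : R -> R -> R) (a b c d : R) :
  a < b -> c < d ->
  (forall x y, a <= x <= b -> c <= y <= d -> exists px k qy,
     differentiable_pt_lim P x y px k /\ differentiable_pt_lim Q x y k qy) ->
  boundary_integral P Q a b c d = 0.
Proof.
  intros Hab Hcd Hdiff.
  assert (HC : forall x y, a <= x <= b -> c <= y <= d ->
     continuity_2d_pt P x y /\ continuity_2d_pt Q x y).
  { intros x y Hx Hy; destruct (Hdiff x y Hx Hy) as [px [k [qy [DP DQ]]]].
    split; apply differentiable_continuity_pt; eexists; eexists; eassumption. }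
  set (w := b - a); set (h := d - c).
  assert (Hw : 0 < w) by (unfold w; lra); assert (Hh : 0 < h) by (unfold h; lra).
  set (E := Rabs (boundary_integral P Q a b c d)).
  assert (Hpow : forall n, 0 < 2 ^ n) by (intros n; apply pow_lt; lra).
  assert (Hpos : forall s n, 0 < s -> 0 < s / 2 ^ n).
  { intros s n Hs; apply Rdiv_lt_0_compat; auto. }
  assert (Hhalf : forall s n, s / 2 ^ n = s / 2 ^ S n + s / 2 ^ S n).
  { intros s n; simpl; field; pose proof (Hpow n); lra. }
  pose (Bad := fun x y n =>
    a <= x /\ x + w / 2 ^ n <= b /\ c <= y /\ y + h / 2 ^ n <= d /\
    E <= (2 ^ n) ^ 2 * Rabs (boundary_integral P Q x (x + w / 2 ^ n) y (y + h / 2 ^ n))).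
  destruct (rectangle_bisection w h a c Bad Hw Hh) as [p [q Hpq]].
  - unfold Bad; simpl; rewrite !Rdiv_1_r.
    replace (a + w) with b by (unfold w; ring).
    replace (c + h) with d by (unfold h; ring).
    fold E; repeat split; lra.
  - intros x y n [Hx1 [Hx2 [Hy1 [Hy2 HE]]]].
    pose proof (Hpos w (S n) Hw) as Hws; pose proof (Hpos h (S n) Hh) as Hhs.
    assert (Hbad : forall x' y', (x' = x \/ x' = x + w / 2 ^ S n) ->
       (y' = y \/ y' = y + h / 2 ^ S n) -> ~ Bad x' y' (S n) ->
       4 * (2 ^ n) ^ 2 * Rabs (boundary_integral P Q x' (x' + w / 2 ^ S n) y' (y' + h / 2 ^ S n)) < E).
    { intros x' y' Hx' Hy' HB; apply Rnot_le_lt; intros Hle; apply HB.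
      rewrite (Hhalf w n) in Hx2; rewrite (Hhalf h n) in Hy2.
      unfold Bad; do 4 (split; [destruct Hx'; destruct Hy'; subst x' y'; lra|]).
      replace ((2 ^ S n) ^ 2) with (4 * (2 ^ n) ^ 2) by (simpl; ring); exact Hle. }
    destruct (excluded_middle_informative (exists x' y',
      (x' = x \/ x' = x + w / 2 ^ S n) /\ (y' = y \/ y' = y + h / 2 ^ S n) /\ Bad x' y' (S n)))
      as [[x' [y' [Hx' [Hy' HB]]]]|Hno].
    + exists x', y'; split; [|split; [|exact HB]];
        [destruct Hx' | destruct Hy']; subst; lra.
    (* If no quarter is bad, each of the four integrals is below [E / 4 ^ S n] in absolute value,
       and their sum contradicts [HE]. *)
    + exfalso.
      assert (Hq : forall x' y', (x' = x \/ x' = x + w / 2 ^ S n) ->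
       (y' = y \/ y' = y + h / 2 ^ S n) ->
       4 * (2 ^ n) ^ 2 * Rabs (boundary_integral P Q x' (x' + w / 2 ^ S n) y' (y' + h / 2 ^ S n)) < E).
      { intros x' y' Hx' Hy'; apply Hbad; try assumption.
        intros HB; apply Hno; exists x', y'; auto. }
      rewrite (Hhalf w n) in HE, Hx2; rewrite (Hhalf h n) in HE, Hy2.
      rewrite <- !Rplus_assoc in HE.
      rewrite (boundary_integral_split P Q x (x + w / 2 ^ S n) _ y (y + h / 2 ^ S n)) in HE;
        try lra.
      2: { intros s t Hs Ht; apply HC; lra. }
      pose proof (Hq x y (or_introl eq_refl) (or_introl eq_refl)) as Q1.
      pose proof (Hq _ y (or_intror eq_refl) (or_introl eq_refl)) as Q2.
      pose proof (Hq x _ (or_introl eq_refl) (or_intror eq_refl)) as Q3.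
      pose proof (Hq _ _ (or_intror eq_refl) (or_intror eq_refl)) as Q4.
      revert HE Q1 Q2 Q3 Q4.
      generalize (boundary_integral P Q x (x + w / 2 ^ S n) y (y + h / 2 ^ S n)).
      generalize (boundary_integral P Q (x + w / 2 ^ S n) (x + w / 2 ^ S n + w / 2 ^ S n) y (y + h / 2 ^ S n)).
      generalize (boundary_integral P Q x (x + w / 2 ^ S n) (y + h / 2 ^ S n) (y + h / 2 ^ S n + h / 2 ^ S n)).
      generalize (boundary_integral P Q (x + w / 2 ^ S n) (x + w / 2 ^ S n + w / 2 ^ S n) (y + h / 2 ^ S n) (y + h / 2 ^ S n + h / 2 ^ S n)).
      intros r1 r2 r3 r4 HE Q1 Q2 Q3 Q4.
      assert (Htri : Rabs (r4 + r3 + r2 + r1) <= Rabs r4 + Rabs r3 + Rabs r2 + Rabs r1).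
      { pose proof (Rabs_triang (r4 + r3 + r2) r1); pose proof (Rabs_triang (r4 + r3) r2);
        pose proof (Rabs_triang r4 r3); lra. }
      assert (0 < (2 ^ n) ^ 2) by (apply pow_lt, Hpow).
      apply (Rmult_le_compat_l ((2 ^ n) ^ 2)) in Htri; lra.
  - assert (Hin : a <= p <= b /\ c <= q <= d).
    { destruct (Hpq 0%nat) as [x [y [Hx [Hy [B1 [B2 [B3 [B4 _]]]]]]]]; lra. }
    destruct (Hdiff p q) as [px [k [qy [DP DQ]]]]; try lra.
    assert (HE : forall eps : posreal, E <= eps).
    { intros eps.
      (* At level [n] the affine error is at most this constant times [(w + h) / 2 ^ n]. The bound
         [2 * e * (u + v)], with [u + v = (w + h) / 2 ^ n], then becomes exactly [eps] after
         multiplication by [4 ^ n]. *)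
      assert (He : 0 < eps / (2 * (w + h) ^ 2)).
      { apply Rdiv_lt_0_compat; [apply cond_pos|]; nra. }
      destruct (DP (mkposreal _ He)) as [d1 Hd1].
      destruct (DQ (mkposreal _ He)) as [d2 Hd2]; simpl in Hd1, Hd2.
      assert (Hn : exists n, (w + h) / 2 ^ n < Rmin d1 d2).
      { assert (Hm : 0 < Rmin d1 d2 / (w + h)).
        { apply Rdiv_lt_0_compat; [apply Rmin_pos; apply cond_pos | lra]. }
        destruct (pow_lt_1_zero (/2) ltac:(rewrite Rabs_pos_eq; lra) _ Hm) as [n Hn].
        exists n; specialize (Hn n (Nat.le_refl n)).
        rewrite pow_inv, Rabs_pos_eq in Hn.
        2: { left; apply Rinv_0_lt_compat, Hpow. }
        apply (Rmult_lt_compat_l (w + h)) in Hn; [|lra].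
        replace ((w + h) * (Rmin d1 d2 / (w + h))) with (Rmin d1 d2) in Hn by (field; lra).
        exact Hn. }
      destruct Hn as [n Hn].
      destruct (Hpq n) as [x [y [Hx [Hy [B1 [B2 [B3 [B4 B5]]]]]]]].
      pose proof (Hpos w n Hw) as Hwn; pose proof (Hpos h n Hh) as Hhn.
      pose proof (Rmin_l d1 d2); pose proof (Rmin_r d1 d2).
      assert (Hwh : (w + h) / 2 ^ n = w / 2 ^ n + h / 2 ^ n) by (unfold Rdiv; ring).
      pose proof (boundary_integral_small P Q x y (w / 2 ^ n) (h / 2 ^ n) p q px k qy
         (eps / (2 * (w + h) ^ 2) * ((w + h) / 2 ^ n))) as Hsmall.
      refine (Rle_trans _ _ _ B5 _).
      refine (Rle_trans _ _ _ (Rmult_le_compat_l _ _ _ _ (Hsmall _ _ _ _ _)) _); try lra.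
      + left; apply pow_lt, Hpow.
      + intros s t Hs Ht; destruct (HC s t) as [C1 C2]; try lra.
        assert (Hs' : Rabs (s - p) <= (w + h) / 2 ^ n) by (apply Rabs_le_between; lra).
        assert (Ht' : Rabs (t - q) <= (w + h) / 2 ^ n) by (apply Rabs_le_between; lra).
        assert (Hm : Rmax (Rabs (s - p)) (Rabs (t - q)) <= (w + h) / 2 ^ n)
          by (apply Rmax_lub; assumption).
        apply (Rmult_le_compat_l (eps / (2 * (w + h) ^ 2))) in Hm; [|lra].
        split; [exact C1|]; split; [exact C2|]; split;
          (eapply Rle_trans; [|exact Hm]); [apply Hd1 | apply Hd2]; lra.
      + right; rewrite <- Hwh; field; split; [pose proof (Hpow n); lra | lra]. }
    assert (HE0 : E = 0).
    { apply Rle_antisym; [|apply Rabs_pos].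
      apply le_epsilon; intros e He; rewrite Rplus_0_l; apply (HE (mkposreal e He)). }
    destruct (Req_dec (boundary_integral P Q a b c d) 0) as [Z|Z]; [exact Z|].
    exfalso; exact (Rabs_no_R0 _ Z HE0).
Qed.

(** * Complex derivatives and circle integrals *)

Lemma is_derive_C_iff (f : C -> C) (z l : C) :
  is_derive f z l <->
  forall eps, 0 < eps -> exists d, 0 < d /\ forall w, Cmod (w - z) < d ->
    Cmod (f w - f z - l * (w - z)) <= eps * Cmod (w - z).
Proof.
  split.
  - intros [_ Hf] eps Heps.
    destruct (Hf z (fun P HP => HP) (mkposreal eps Heps)) as [d Hd].
    exists d; split; [apply cond_pos|]; intros w Hw.
    specialize (Hd w Hw).
    replace (f w - f z - l * (w - z))%C with (f w - f z - (w - z) * l)%C by ring.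
    exact Hd.
  - intros Hf; split; [apply is_linear_scal_l|].
    intros x Hx.
    rewrite <- (is_filter_lim_locally_unique (V := AbsRing_NormedModule C_AbsRing) z x Hx).
    intros eps; destruct (Hf eps (cond_pos eps)) as [d [Hd Hw]].
    exists (mkposreal d Hd); intros w Hwz; specialize (Hw w Hwz).
    replace (f w - f z - l * (w - z))%C with (f w - f z - (w - z) * l)%C in Hw by ring.
    exact Hw.
Qed.


(* [C] carries two normed-module structures over itself in Coquelicot: their uniform
   structures are not convertible, their norms are. *)
Lemma is_derive_C_AbsRing (f : C -> C) (z l : C) :
  is_derive (V := C_NormedModule) f z l <->
  is_derive (V := AbsRing_NormedModule C_AbsRing) f z l.
Proof.
  split; intros [_ Hf]; (split; [apply is_linear_scal_l | exact Hf]).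
Qed.

Lemma is_derive_C_mult (f g : C -> C) (z l m : C) :
  is_derive f z l -> is_derive g z m ->
  is_derive (fun w => f w * g w)%C z (l * g z + f z * m)%C.
Proof.
  intros Hf Hg; apply is_derive_C_AbsRing.
  apply (is_derive_mult (K := C_AbsRing) f g z l m).
  - apply is_derive_C_AbsRing, Hf.
  - apply is_derive_C_AbsRing, Hg.
  - exact Cmult_comm.
Qed.

Lemma Cminus_neq_0 (z w : C) : z <> w -> (z - w)%C <> 0.
Proof.
  intros Hzw E; apply Hzw.
  replace z with (z - w + w)%C by ring; rewrite E; ring.
Qed.

Lemma is_derive_C_inv_minus (a z : C) :
  z <> a -> is_derive (fun w => / (w - a))%C z (- / ((z - a) * (z - a)))%C.
Proof.
  intros Hza; apply is_derive_C_iff; intros eps Heps.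
  assert (Hm : (z - a)%C <> 0) by (apply Cminus_neq_0, Hza).
  pose proof (proj1 (Cmod_gt_0 _) Hm) as HM; set (M := Cmod (z - a)) in *.
  (* The error is [(w - z)^2 / ((w - a) * (z - a)^2)]. The first radius gives
     [M / 2 <= Cmod (w - a)], the second then makes the remaining factor at most [eps]. *)
  exists (Rmin (M / 2) (eps * M ^ 3 / 2)); split.
  { apply Rmin_pos; [lra|]; assert (0 < M ^ 3) by (apply pow_lt; exact HM); nra. }
  intros w Hw.
  pose proof (Rlt_le_trans _ _ _ Hw (Rmin_l _ _)) as Hw1.
  pose proof (Rlt_le_trans _ _ _ Hw (Rmin_r _ _)) as Hw2.
  assert (Hwa : M / 2 <= Cmod (w - a)).
  { pose proof (Cmod_triangle (w - a) (- (w - z))) as T; rewrite Cmod_opp in T.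
    replace (w - a + - (w - z))%C with (z - a)%C in T by ring; fold M in T; lra. }
  assert (Hwn : (w - a)%C <> 0) by (apply Cmod_gt_0; lra).
  replace (/ (w - a) - / (z - a) - - / ((z - a) * (z - a)) * (w - z))%C
    with ((w - z) * ((w - z) / ((w - a) * ((z - a) * (z - a)))))%C by (field; auto).
  rewrite Cmod_mult, Rmult_comm, Cmod_div, !Cmod_mult by (repeat apply Cmult_neq_0; assumption).
  fold M; apply Rmult_le_compat_r; [apply Cmod_ge_0|].
  assert (HMM : 0 < M * M) by (apply Rmult_lt_0_compat; exact HM).
  apply Rle_div_l; [apply Rmult_lt_0_compat; lra|].
  assert (M * M * (M / 2) <= M * M * Cmod (w - a)) by (apply Rmult_le_compat_l; lra).
  apply Rle_trans with (eps * (M * M * (M / 2))).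
  - replace (eps * (M * M * (M / 2))) with (eps * M ^ 3 / 2) by (unfold Rdiv; ring); lra.
  - rewrite (Rmult_comm (Cmod (w - a))); apply Rmult_le_compat_l; lra.
Qed.

Lemma Cmod_le_Rabs (z : C) : Cmod z <= Rabs (Re z) + Rabs (Im z).
Proof.
  destruct z as [x y]; simpl.
  pose proof (Cmod_triangle (RtoC x) (0, y)) as T.
  replace (RtoC x + (0, y))%C with ((x, y) : C) in T
    by (unfold RtoC, Cplus; simpl; f_equal; ring).
  rewrite Cmod_R in T; unfold Cmod at 2 in T; simpl in T.
  replace (0 * (0 * 1) + y * (y * 1)) with (y ^ 2) in T by ring.
  rewrite <- Rsqr_pow2, sqrt_Rsqr_abs in T; exact T.
Qed.

Lemma Re_le_Cmod (z : C) : Re z <= Cmod z.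
Proof. pose proof (re_le_Cmod z); pose proof (Rle_abs (Re z)); lra. Qed.

Lemma Im_abs_le_Cmod (z : C) : Rabs (Im z) <= Cmod z.
Proof. exact (Rle_trans _ _ _ (Rmax_r _ _) (Rmax_Cmod z)). Qed.

Lemma cauchy_riemann (f : C -> C) (x y : R) (l : C) :
  is_derive f (x, y) l ->
  differentiable_pt_lim (fun u v => Re (f (u, v))) x y (Re l) (- Im l) /\
  differentiable_pt_lim (fun u v => Im (f (u, v))) x y (Im l) (Re l).
Proof.
  intros Hf; rewrite is_derive_C_iff in Hf.
  assert (Hmain : forall eps : posreal, locally_2d (fun u v =>
    Cmod (f (u, v) - f (x, y) - l * ((u, v) - (x, y))) <=
      eps * Rmax (Rabs (u - x)) (Rabs (v - y))) x y).
  (* Both [eps] and [d] are halved because [Cmod] is at most twice the larger coordinate in absolute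
     value. *)
  { intros eps; destruct (Hf (eps / 2)) as [d [Hd Hw]]; [pose proof (cond_pos eps); lra|].
    assert (Hd2 : 0 < d / 2) by lra.
    exists (mkposreal _ Hd2); simpl; intros u v Hu Hv.
    pose proof (Cmod_le_Rabs ((u, v) - (x, y))) as HC; simpl in HC.
    change (u + - x) with (u - x) in HC; change (v + - y) with (v - y) in HC.
    pose proof (Rmax_l (Rabs (u - x)) (Rabs (v - y))).
    pose proof (Rmax_r (Rabs (u - x)) (Rabs (v - y))).
    eapply Rle_trans; [apply Hw; lra|].
    apply Rle_trans with (eps / 2 * (2 * Rmax (Rabs (u - x)) (Rabs (v - y)))); [|lra].
    apply Rmult_le_compat_l; [pose proof (cond_pos eps)|]; lra. }
  split; intros eps; destruct (Hmain eps) as [d Hd]; exists d; intros u v Hu Hv;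
    specialize (Hd u v Hu Hv).
  - eapply Rle_trans; [|exact Hd].
    eapply Rle_trans; [|apply re_le_Cmod].
    right; f_equal; unfold Re, Im; simpl; ring.
  - eapply Rle_trans; [|exact Hd].
    eapply Rle_trans; [|apply Im_abs_le_Cmod].
    right; f_equal; unfold Re, Im; simpl; ring.
Qed.

Lemma differentiable_pt_lim_mult (x y : R) :
  differentiable_pt_lim Rmult x y y x.
Proof.
  intros eps; exists eps; intros u v Hu Hv.
  replace (u * v - x * y - (y * (u - x) + x * (v - y))) with ((u - x) * (v - y)) by ring.
  rewrite Rabs_mult.
  apply Rmult_le_compat; try apply Rabs_pos; [lra | apply Rmax_r].
Qed.

Lemma differentiable_pt_lim_proj2 (f : R -> R) (x y l : R) :
  derivable_pt_lim f y l -> differentiable_pt_lim (fun _ v => f v) x y 0 l.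
Proof.
  intros Hf eps.
  destruct (proj2 (is_derive_Reals f y l) Hf) as [_ Hd].
  destruct (Hd y (fun P HP => HP) eps) as [d Hd'].
  exists d; intros u v Hu Hv; specialize (Hd' v Hv).
  eapply Rle_trans; [|apply Rmult_le_compat_l; [left; apply cond_pos | apply Rmax_r]].
  refine (Rle_trans _ _ _ _ Hd'); right.
  unfold norm, minus, plus, opp, scal; simpl; unfold abs, mult; simpl; f_equal; ring.
Qed.

(** * Polar coordinates and independence of the radius *)

Definition polar (r t : R) : C := (r * cos t, r * sin t).

Lemma differentiable_pt_lim_polar (F : R -> R -> R) (r t lx ly : R) :
  differentiable_pt_lim F (r * cos t) (r * sin t) lx ly ->
  differentiable_pt_lim (fun r t => F (r * cos t) (r * sin t)) r t
    (lx * cos t + ly * sin t) (r * (ly * cos t - lx * sin t)).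
Proof.
  intros HF.
  assert (Hr : differentiable_pt_lim (fun u _ => u) r t 1 0).
  { apply (differentiable_pt_lim_proj1_0 (fun u => u)), derivable_pt_lim_id. }
  pose proof (differentiable_pt_lim_comp Rmult (fun u _ => u) (fun _ v => cos v) r t
    _ _ _ _ _ _ (differentiable_pt_lim_mult _ _) Hr
    (differentiable_pt_lim_proj2 _ r t _ (derivable_pt_lim_cos t))) as Hc.
  pose proof (differentiable_pt_lim_comp Rmult (fun u _ => u) (fun _ v => sin v) r t
    _ _ _ _ _ _ (differentiable_pt_lim_mult _ _) Hr
    (differentiable_pt_lim_proj2 _ r t _ (derivable_pt_lim_sin t))) as Hs.
  pose proof (differentiable_pt_lim_comp F _ _ r t _ _ _ _ _ _ HF Hc Hs) as H.
  replace (lx * cos t + ly * sin t)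
    with (lx * (cos t * 1 + r * 0) + ly * (sin t * 1 + r * 0)) by ring.
  replace (r * (ly * cos t - lx * sin t))
    with (lx * (cos t * 0 + r * - sin t) + ly * (sin t * 0 + r * cos t)) by ring.
  exact H.
Qed.

Lemma Cmod_polar (r t : R) : 0 <= r -> Cmod (polar r t) = r.
Proof.
  intros Hr; unfold Cmod, polar; simpl.
  replace (_ + _) with (r ^ 2 * (Rsqr (sin t) + Rsqr (cos t))) by (unfold Rsqr; ring).
  rewrite sin2_cos2, Rmult_1_r; apply sqrt_pow2, Hr.
Qed.

(** This is [2 * PI] times the mean of [Re k] over the circle of radius [r]. *)
Definition circle_integral (k : C -> C) (r : R) : R :=
  RInt (fun t => Re (k (polar r t))) 0 (2 * PI).

(* The closed form is [Re (k dz / (i z))] in polar coordinates; its radial parts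
   on the two sides [t = 0] and [t = 2 * PI] of the rectangle agree. *)
Lemma circle_integral_const (k : C -> C) (r1 r2 : R) :
  0 < r1 < r2 -> (forall z, r1 <= Cmod z <= r2 -> ex_derive k z) ->
  circle_integral k r1 = circle_integral k r2.
Proof.
  intros Hr Hk.
  set (Q := fun r t => Re (k (polar r t))).
  set (P := fun r t => Im (k (polar r t)) * / r).
  assert (HG : boundary_integral P Q r1 r2 0 (2 * PI) = 0).
  { pose proof PI_RGT_0.
    apply goursat_rectangle; [lra | lra |].
    intros r t Hr' _.
    destruct (Hk (polar r t)) as [l Hl]; [rewrite Cmod_polar; lra|].
    destruct (cauchy_riemann _ _ _ _ Hl) as [HRe HIm].
    pose proof (differentiable_pt_lim_polar _ _ _ _ _ HRe) as DQ.
    pose proof (differentiable_pt_lim_polar _ _ _ _ _ HIm) as DI.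
    assert (Dinv : differentiable_pt_lim (fun u _ => / u) r t (- 1 / r ^ 2) 0).
    { apply (differentiable_pt_lim_proj1_0 (fun u => / u)).
      apply is_derive_Reals; auto_derive; [lra|]; field; lra. }
    pose proof (differentiable_pt_lim_comp Rmult _ _ r t _ _ _ _ _ _
      (differentiable_pt_lim_mult _ _) DI Dinv) as DP.
    (* Cauchy-Riemann in polar coordinates: this number is the [r]-derivative of [Re k] and [1 / r]
       times the [t]-derivative of [Im k]. *)
    eexists; exists (Re l * cos t - Im l * sin t); eexists; split.
    - evar (k' : R); replace (Re l * cos t - Im l * sin t) with k'; [exact DP|].
      unfold k'; field; lra.
    - replace (Re l * cos t - Im l * sin t) with (Re l * cos t + - Im l * sin t) by ring.
      exact DQ. }
  unfold boundary_integral in HG.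
  assert (HP : RInt (fun x => P x 0) r1 r2 = RInt (fun x => P x (2 * PI)) r1 r2).
  { apply RInt_ext; intros x _; unfold P, polar.
    rewrite cos_2PI, sin_2PI, cos_0, sin_0; reflexivity. }
  change (RInt (Q r1) 0 (2 * PI) = RInt (Q r2) 0 (2 * PI)); rewrite HP in HG.
  change (fun y => Q r1 y) with (Q r1) in HG; change (fun y => Q r2 y) with (Q r2) in HG.
  lra.
Qed.

(** * Continuity and the mean value property with an exceptional point *)

Definition continuous_C (k : C -> C) (z : C) : Prop :=
  forall eps, 0 < eps -> exists d, 0 < d /\
    forall w, Cmod (w - z) < d -> Cmod (k w - k z) <= eps.

Lemma ex_derive_continuous_C (k : C -> C) (z : C) :
  ex_derive k z -> continuous_C k z.
Proof.
  intros [l Hl] eps Heps; rewrite is_derive_C_iff in Hl.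
  destruct (Hl 1 Rlt_0_1) as [d [Hd Hw]].
  pose proof (Cmod_ge_0 l) as Hl0.
  assert (Hq : 0 < eps / (1 + Cmod l)) by (apply Rdiv_lt_0_compat; lra).
  exists (Rmin d (eps / (1 + Cmod l))); split; [apply Rmin_pos; lra|].
  intros w Hwz.
  pose proof (Rlt_le_trans _ _ _ Hwz (Rmin_l _ _)) as H1.
  pose proof (Rlt_le_trans _ _ _ Hwz (Rmin_r _ _)) as H2.
  specialize (Hw w H1).
  pose proof (Cmod_triangle (k w - k z - l * (w - z)) (l * (w - z))) as T.
  replace (k w - k z - l * (w - z) + l * (w - z))%C with (k w - k z)%C in T by ring.
  rewrite (Cmod_mult l) in T.
  apply Rlt_div_r in H2; lra.
Qed.

Lemma continuity_2d_pt_polar (k : C -> C) (r t : R) :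
  continuous_C k (polar r t) ->
  continuity_2d_pt (fun r t => Re (k (polar r t))) r t.
Proof.
  intros Hk eps.
  destruct (Hk (eps / 2)) as [d [Hd Hw]]; [pose proof (cond_pos eps); lra|].
  assert (Hd2 : 0 < d / 2) by lra.
  assert (Hx : continuity_2d_pt (fun r t => r * cos t) r t).
  { apply differentiable_continuity_pt; do 2 eexists.
    apply (differentiable_pt_lim_polar (fun u _ => u)).
    apply (differentiable_pt_lim_proj1_0 (fun u => u)), derivable_pt_lim_id. }
  assert (Hy : continuity_2d_pt (fun r t => r * sin t) r t).
  { apply differentiable_continuity_pt; do 2 eexists.
    apply (differentiable_pt_lim_polar (fun _ v => v)).
    apply (differentiable_pt_lim_proj2 (fun v => v)), derivable_pt_lim_id. }
  destruct (Hx (mkposreal _ Hd2)) as [d1 H1]; destruct (Hy (mkposreal _ Hd2)) as [d2 H2].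
  assert (Hd12 : 0 < Rmin d1 d2) by (apply Rmin_pos; apply cond_pos).
  exists (mkposreal _ Hd12); simpl; simpl in H1, H2; intros u v Hu Hv.
  pose proof (Rmin_l d1 d2); pose proof (Rmin_r d1 d2).
  specialize (H1 u v ltac:(lra) ltac:(lra)); specialize (H2 u v ltac:(lra) ltac:(lra)).
  apply Rle_lt_trans with (eps / 2); [|pose proof (cond_pos eps); lra].
  refine (Rle_trans _ _ _ _ (Hw (polar u v) _)).
  - refine (Rle_trans _ _ _ _ (re_le_Cmod _)); right; f_equal; unfold Re; simpl; ring.
  - eapply Rle_lt_trans; [apply Cmod_le_Rabs|]; simpl.
    unfold Rminus in H1, H2; lra.
Qed.

Lemma ex_RInt_circle (k : C -> C) (r : R) :
  0 <= r -> (forall z, Cmod z = r -> continuous_C k z) ->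
  ex_RInt (fun t => Re (k (polar r t))) 0 (2 * PI).
Proof.
  intros Hr Hk; pose proof PI_RGT_0.
  apply (ex_RInt_column (fun r t => Re (k (polar r t)))); [lra|].
  intros t _; apply continuity_2d_pt_polar, Hk, Cmod_polar, Hr.
Qed.

Lemma circle_integral_near_const (k : C -> C) (l : C) (r eps : R) :
  0 <= r -> (forall z, Cmod z = r -> continuous_C k z /\ Cmod (k z - l) <= eps) ->
  Rabs (circle_integral k r - 2 * PI * Re l) <= 2 * PI * eps.
Proof.
  intros Hr Hk; pose proof PI_RGT_0.
  pose proof (RInt_difference_near_const (fun t => Re (k (polar r t))) (fun _ => 0)
    0 (2 * PI) (Re l) eps) as H1.
  rewrite RInt_const in H1; unfold scal in H1; simpl in H1; unfold mult in H1; simpl in H1.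
  unfold circle_integral.
  rewrite Rmult_0_r, !Rminus_0_r in H1; apply H1; [lra | | | ].
  - apply ex_RInt_circle; [exact Hr|]; intros z Hz; apply Hk, Hz.
  - apply ex_RInt_const.
  - intros t _; destruct (Hk (polar r t)) as [_ Hle]; [apply Cmod_polar, Hr|].
    refine (Rle_trans _ _ _ _ Hle); refine (Rle_trans _ _ _ _ (re_le_Cmod _)).
    right; f_equal; unfold Re; simpl; ring.
Qed.

(** Continuity in [r] is uniform in the angle, which ranges over a compact interval. This carries
    the mean value across the circle through an exceptional point. *)
Lemma circle_integral_continuous (k : C -> C) (r0 : R) :
  0 < r0 < 1 -> (forall z, 0 < Cmod z < 1 -> continuous_C k z) ->
  forall eps, 0 < eps -> exists d, 0 < d /\
    forall r, 0 < r < 1 -> Rabs (r - r0) < d ->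
      Rabs (circle_integral k r - circle_integral k r0) <= eps.
Proof.
  intros Hr0 Hk eps Heps; pose proof PI_RGT_0.
  assert (He : 0 < eps / (2 * PI)) by (apply Rdiv_lt_0_compat; lra).
  destruct (uniform_continuity_2d_1d' (fun r t => Re (k (polar r t))) 0 (2 * PI) r0)
    with (eps := mkposreal _ He) as [d Hd].
  { intros t _; apply continuity_2d_pt_polar, Hk; rewrite Cmod_polar; lra. }
  exists d; split; [apply cond_pos|]; intros r Hr Hrr0; simpl in Hd.
  apply Rabs_def2 in Hrr0.
  pose proof (RInt_difference_near_const (fun t => Re (k (polar r t)))
    (fun t => Re (k (polar r0 t))) 0 (2 * PI) 0 (eps / (2 * PI))) as H1.
  rewrite Rmult_0_r, !Rminus_0_r in H1.
  replace (2 * PI * (eps / (2 * PI))) with eps in H1 by (field; lra).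
  apply H1; [lra | | | ].
  - apply ex_RInt_circle; [lra|]; intros z Hz; apply Hk; lra.
  - apply ex_RInt_circle; [lra|]; intros z Hz; apply Hk; lra.
  - intros t Ht; left; rewrite Rminus_0_r.
    pose proof (cond_pos d).
    apply Hd; try lra; rewrite Rminus_diag, Rabs_R0; lra.
Qed.

Lemma Rabs_le_all_eps (x : R) :
  (forall eps, 0 < eps -> Rabs x <= eps) -> x = 0.
Proof.
  intros Hx; destruct (Req_dec x 0) as [Z|Z]; [exact Z|].
  pose proof (Rabs_pos_lt x Z); specialize (Hx (Rabs x / 2)); lra.
Qed.

(** The integral is constant in [r] on either side of [Cmod p] and continuous at [Cmod p], so it
    equals its limit as [r] tends to [0]. That limit is given by [l], whatever the value of [k] at
    [0]. *)
Lemma circle_integral_mean_value (k : C -> C) (p l : C) (r : R) :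
  (forall z, 0 < Cmod z < 1 -> z <> p -> ex_derive k z) ->
  (0 < Cmod p -> continuous_C k p) ->
  (forall eps, 0 < eps -> exists d, 0 < d /\
     forall z, 0 < Cmod z < d -> Cmod (k z - l) <= eps) ->
  0 < r < 1 -> circle_integral k r = 2 * PI * Re l.
Proof.
  intros Hk Hp Hl Hr; pose proof PI_RGT_0 as HPI.
  assert (HC : forall z, 0 < Cmod z < 1 -> continuous_C k z).
  { intros z Hz; destruct (Ceq_dec z p) as [->|Hzp]; [apply Hp; lra|].
    apply ex_derive_continuous_C, Hk; assumption. }
  assert (Hconst : forall r1 r2, 0 < r1 < r2 -> r2 < 1 -> ~ (r1 <= Cmod p <= r2) ->
    circle_integral k r1 = circle_integral k r2).
  { intros r1 r2 H12 H2 Hnp; apply circle_integral_const; [exact H12|].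
    intros z Hz; apply Hk; [lra|]; intros ->; contradiction. }
  (* Circles that do not enclose [p], or any circle when [p] is the origin, can be shrunk to [0]
     without meeting [p]. *)
  assert (Hinner : forall s, 0 < s < 1 -> (s < Cmod p \/ Cmod p = 0) ->
    circle_integral k s = 2 * PI * Re l).
  { intros s Hs Hsp; apply Rminus_diag_uniq, Rabs_le_all_eps; intros eps Heps.
    destruct (Hl (eps / (2 * PI))) as [d [Hd Hz]]; [apply Rdiv_lt_0_compat; lra|].
    pose proof (Rmin_l d s); pose proof (Rmin_r d s).
    assert (0 < Rmin d s) by (apply Rmin_pos; lra).
    rewrite <- (Hconst (Rmin d s / 2) s) by lra.
    replace eps with (2 * PI * (eps / (2 * PI))) by (field; lra).
    apply circle_integral_near_const; [lra|]; intros z Hzr; split.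
    - apply HC; lra.
    - apply Hz; lra. }
  pose proof (Cmod_ge_0 p) as Hp0.
  assert (Hon : 0 < Cmod p < 1 -> circle_integral k (Cmod p) = 2 * PI * Re l).
  { intros Hp1; apply Rminus_diag_uniq, Rabs_le_all_eps; intros eps Heps.
    destruct (circle_integral_continuous k (Cmod p) Hp1 HC eps Heps) as [d [Hd Hs]].
    pose proof (Rmin_l d (Cmod p)); pose proof (Rmin_r d (Cmod p)).
    assert (0 < Rmin d (Cmod p)) by (apply Rmin_pos; lra).
    specialize (Hs (Cmod p - Rmin d (Cmod p) / 2)).
    rewrite Hinner in Hs by lra.
    rewrite Rabs_minus_sym; apply Hs; [lra|]; apply Rabs_def1; lra. }
  destruct (Rle_lt_dec (Cmod p) 0) as [Hz|Hz]; [apply Hinner; lra|].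
  destruct (Rtotal_order r (Cmod p)) as [Hlt|[Heq|Hgt]].
  - apply Hinner; lra.
  - rewrite Heq; apply Hon; lra.
  (* Beyond [Cmod p] the integral is again constant; its value is found by letting the radius
     decrease to [Cmod p]. *)
  - rewrite <- Hon by lra.
    apply Rminus_diag_uniq, Rabs_le_all_eps; intros eps Heps.
    destruct (circle_integral_continuous k (Cmod p) ltac:(lra) HC eps Heps) as [d [Hd Hs]].
    pose proof (Rmin_l d (r - Cmod p)); pose proof (Rmin_r d (r - Cmod p)).
    assert (0 < Rmin d (r - Cmod p)) by (apply Rmin_pos; lra).
    specialize (Hs (Cmod p + Rmin d (r - Cmod p) / 2)).
    rewrite (Hconst _ r) in Hs by lra.
    apply Hs; [lra|]; apply Rabs_def1; lra.
Qed.

(** * Rigidity in the Schwarz lemma *)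

Lemma is_derive_C_minus_affine (f : C -> C) (z l a b : C) :
  is_derive f z l -> is_derive (fun w => f w - a * w - b)%C z (l - a)%C.
Proof.
  rewrite !is_derive_C_iff; intros Hf eps Heps.
  destruct (Hf eps Heps) as [d [Hd Hw]]; exists d; split; [exact Hd|].
  intros w Hwz; specialize (Hw w Hwz).
  replace (f w - a * w - b - (f z - a * z - b) - (l - a) * (w - z))%C
    with (f w - f z - l * (w - z))%C by ring.
  exact Hw.
Qed.

Lemma ex_derive_C_quotient (f : C -> C) (a z : C) :
  ex_derive f z -> z <> a -> ex_derive (fun w => f w / (w - a))%C z.
Proof.
  intros [l Hl] Hza; eexists.
  apply (is_derive_C_mult f (fun w => / (w - a))%C); [exact Hl|].
  apply is_derive_C_inv_minus, Hza.
Qed.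

Lemma ex_derive_C_minus_const (f : C -> C) (z b : C) :
  ex_derive f z -> ex_derive (fun w => f w - b)%C z.
Proof.
  intros [l Hl]; exists (l - 0)%C.
  apply (is_derive_ext (fun w => f w - 0 * w - b)%C).
  - intros w; change ((f w - 0 * w - b)%C = (f w - b)%C); ring.
  - apply is_derive_C_minus_affine, Hl.
Qed.

Lemma ex_derive_C_mult (f g : C -> C) (z : C) :
  ex_derive f z -> ex_derive g z -> ex_derive (fun w => f w * g w)%C z.
Proof.
  intros [l Hl] [m Hm]; eexists; apply is_derive_C_mult; eassumption.
Qed.

Lemma ex_derive_C_id (z : C) : ex_derive (fun w : C => w) z.
Proof. exists (RtoC 1); apply is_derive_C_AbsRing; exact (is_derive_id (K := C_AbsRing) z). Qed.

(** The difference quotient extends continuously across [z0], and the factor [z] makes the value at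
    the origin vanish. *)
Lemma circle_integral_slope (f : C -> C) (c z0 : C) (r : R) :
  (forall z, Cmod z < 1 -> ex_derive f z) -> 0 < Cmod z0 < 1 ->
  0 < r < 1 -> r <> Cmod z0 ->
  circle_integral (fun z => c * (z * ((f z - f z0) / (z - z0))))%C r = 0.
Proof.
  intros Hf Hz0 Hr Hrz0.
  destruct (Hf z0 ltac:(lra)) as [l Hl].
  (* At [z0] the plain formula evaluates to [0]; it is replaced there by its limit. *)
  pose (k := fun z => if Ceq_dec z z0 then (c * (z0 * l))%C
                      else (c * (z * ((f z - f z0) / (z - z0))))%C).
  assert (Hkeq : forall z, z <> z0 -> k z = (c * (z * ((f z - f z0) / (z - z0))))%C).
  { intros z Hz; unfold k; destruct (Ceq_dec z z0); [contradiction | reflexivity]. }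
  assert (Hk : forall z, Cmod z < 1 -> z <> z0 -> ex_derive k z).
  { intros z Hz Hzz0.
    apply (ex_derive_ext_loc (fun z => c * (z * ((f z - f z0) / (z - z0))))%C).
    - assert (Hd : 0 < Cmod (z - z0)) by (apply Cmod_gt_0, Cminus_neq_0, Hzz0).
      exists (mkposreal _ Hd); intros w Hw; symmetry; apply Hkeq; intros ->.
      change (Cmod (z0 - z) < Cmod (z - z0)) in Hw.
      replace (z0 - z)%C with (- (z - z0))%C in Hw by ring; rewrite Cmod_opp in Hw; lra.
    - apply (ex_derive_C_mult (fun _ => c)); [apply ex_derive_const|].
      apply (ex_derive_C_mult (fun w => w)); [apply ex_derive_C_id|].
      apply (ex_derive_C_quotient (fun w => f w - f z0)%C); [|exact Hzz0].
      apply ex_derive_C_minus_const, Hf, Hz. }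
  assert (H0z0 : RtoC 0 <> z0) by (intros E; rewrite <- E, Cmod_0 in Hz0; lra).
  transitivity (circle_integral k r).
  { apply RInt_ext; intros t _; rewrite Hkeq; [reflexivity|].
    intros E; apply Hrz0; rewrite <- E, Cmod_polar; lra. }
  rewrite (circle_integral_mean_value k z0 0 r); [simpl; ring | | | | exact Hr].
  - intros z Hz; apply Hk; lra.
  - intros _ eps Heps.
    pose proof (Cmod_ge_0 c) as Hc.
    (* The difference [k w - k z0] is [c] times two terms, [z0 * q] and [f w - f z0], each bounded
       by this number; the [+ 1] covers [c = 0]. *)
    assert (He : 0 < eps / (2 * (Cmod c + 1))) by (apply Rdiv_lt_0_compat; lra).
    destruct (ex_derive_continuous_C f z0 (Hf z0 ltac:(lra)) _ He) as [d1 [Hd1 H1]].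
    rewrite is_derive_C_iff in Hl.
    destruct (Hl _ He) as [d2 [Hd2 H2]].
    exists (Rmin d1 d2); split; [apply Rmin_pos; lra|]; intros w Hw.
    specialize (H1 w (Rlt_le_trans _ _ _ Hw (Rmin_l _ _))).
    specialize (H2 w (Rlt_le_trans _ _ _ Hw (Rmin_r _ _))).
    destruct (Ceq_dec w z0) as [->|Hwz].
    { replace (k z0 - k z0)%C with (RtoC 0) by ring; rewrite Cmod_0; lra. }
    pose proof (Cminus_neq_0 _ _ Hwz) as Hn; pose proof (proj1 (Cmod_gt_0 _) Hn).
    set (q := ((f w - f z0 - l * (w - z0)) / (w - z0))%C).
    assert (Hq : Cmod q <= eps / (2 * (Cmod c + 1))).
    { unfold q; rewrite Cmod_div by exact Hn; apply Rle_div_l; assumption. }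
    replace (k w - k z0)%C with (c * (z0 * q + (f w - f z0)))%C.
    2: { rewrite Hkeq by exact Hwz; unfold k; destruct (Ceq_dec z0 z0); [|contradiction].
         unfold q; field; exact Hn. }
    rewrite Cmod_mult.
    pose proof (Cmod_triangle (z0 * q) (f w - f z0)) as T; rewrite Cmod_mult in T.
    assert (Cmod z0 * Cmod q <= 1 * (eps / (2 * (Cmod c + 1)))).
    { apply Rmult_le_compat; try apply Cmod_ge_0; lra. }
    apply Rle_trans with ((Cmod c + 1) * (2 * (eps / (2 * (Cmod c + 1))))).
    + apply Rmult_le_compat; try apply Cmod_ge_0; lra.
    + right; field; lra.
  - intros eps Heps.
    destruct (ex_derive_continuous_C k 0 (Hk 0 ltac:(rewrite Cmod_0; lra) H0z0) eps Heps)
      as [d [Hd Hw]].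
    exists d; split; [exact Hd|]; intros z Hz.
    replace (RtoC 0) with (k 0).
    + apply Hw; replace (z - 0)%C with z by ring; lra.
    + rewrite Hkeq by exact H0z0; ring.
Qed.

Lemma Re_Cmult_Cconj_mult (w u : C) : Re (Cconj w * (w * u)) = Cmod w ^ 2 * Re u.
Proof. rewrite Cmod2_alt; unfold Re, Im; simpl; ring. Qed.

(** The map [1 / (1 - u)] sends the unit disc into the half-plane [Re > 1 / 2]; here [u = a / z]. In
    coordinates, twice the real part of [z * Cconj (z - a)] is [|z|^2 - |a|^2 + |z - a|^2]. *)
Lemma Re_quotient_ge_half (z a : C) :
  Cmod a < Cmod z -> 1 / 2 <= Re (z / (z - a)).
Proof.
  intros Haz.
  assert (Hm : (z - a)%C <> 0).
  { intros E; replace z with (z - a + a)%C in Haz by ring.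
    rewrite E, Cplus_0_l in Haz; lra. }
  pose proof (proj1 (Cmod_gt_0 _) Hm) as Hpos.
  assert (H2 : Cmod a ^ 2 < Cmod z ^ 2).
  { pose proof (Cmod_ge_0 a); nra. }
  assert (H3 : 0 < Cmod (z - a) ^ 2) by (apply pow_lt, Hpos).
  rewrite !Cmod2_alt in H2; rewrite Cmod2_alt in H3.
  destruct z as [x y]; destruct a as [p q].
  change (p ^ 2 + q ^ 2 < x ^ 2 + y ^ 2) in H2.
  change (0 < (x - p) ^ 2 + (y - q) ^ 2) in H3.
  replace (Re ((x, y) / ((x, y) - (p, q))))
    with ((x * (x - p) + y * (y - q)) / ((x - p) ^ 2 + (y - q) ^ 2)).
  - apply (Rle_div_r (1 / 2)); lra.
  - unfold Re; simpl; field; lra.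
Qed.

Lemma schwarz_rigidity (H : C -> C) :
  (forall z, Cmod z < 1 -> ex_derive H z) -> H 0 = 0 -> is_derive H (RtoC 0) (RtoC 1) ->
  (forall z, Cmod z < 1 -> Cmod (H z) < 1) ->
  forall z, Cmod z < 1 -> H z = z.
Proof.
  intros HD H0 HD0 HB z0 Hz0.
  destruct (Ceq_dec z0 0) as [->|Hz0n]; [exact H0|].
  apply Cmod_gt_0 in Hz0n.
  pose proof PI_RGT_0 as HPI.
  pose (g := fun z => (H z / (z - 0))%C).
  assert (Hgd : forall z, 0 < Cmod z < 1 -> ex_derive g z).
  { intros z Hz; apply ex_derive_C_quotient; [apply HD; lra|].
    apply Cmod_gt_0; lra. }
  assert (Hg : forall r, 0 < r < 1 -> circle_integral g r = 2 * PI).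
  { intros r Hr.
    rewrite (circle_integral_mean_value g 0 1 r); [simpl; ring | | | | exact Hr].
    - intros z Hz _; apply Hgd, Hz.
    - rewrite Cmod_0; lra.
    - intros eps Heps; rewrite is_derive_C_iff in HD0.
      destruct (HD0 eps Heps) as [d [Hd Hw]]; exists d; split; [exact Hd|].
      intros z Hz; specialize (Hw z); rewrite H0 in Hw.
      assert (Hzn : z <> 0) by (apply Cmod_gt_0; lra).
      replace (g z - 1)%C with ((H z - 0 - 1 * (z - 0)) / z)%C
        by (unfold g; field; exact Hzn).
      rewrite Cmod_div by exact Hzn; apply Rle_div_l; [lra|].
      replace (z - 0)%C with z in Hw |- * by ring; apply Hw; lra. }
  pose (phi := fun z => (H z - 1 * z - 0)%C).
  assert (Hphi : forall z, Cmod z < 1 -> ex_derive phi z).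
  { intros z Hz; destruct (HD z Hz) as [l Hl].
    eexists; apply is_derive_C_minus_affine, Hl. }
  set (w := phi z0); set (a := Cmod z0) in *.
  (* The factor [Cconj w] turns the contribution of [phi z0 = w] into [|w|^2 * z / (z - z0)], whose
     real part is at least [|w|^2 / 2]. *)
  pose (k := fun z => (Cconj w * (z * ((phi z - phi z0) / (z - z0))))%C).
  assert (Hk : forall r, a < r < 1 -> circle_integral k r = 0).
  { intros r Hr; apply circle_integral_slope; fold a; try lra; exact Hphi. }
  (* The bound is affine in [Re (g z)], so its integral over the circle is known from [Hg]. The
     parameter [eta] is chosen at the end. *)
  assert (Hpoint : forall r eta z, a < r < 1 -> 0 < eta -> Cmod z = r ->
    Re (k z) <= Cmod w / (r - a) * ((eta + (1 + r ^ 2 - 2 * r ^ 2 * Re (g z)) / eta) / 2)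
                - Cmod w ^ 2 / 2).
  { intros r eta z Hr Heta Hz.
    assert (Hzn : z <> 0) by (apply Cmod_gt_0; lra).
    assert (Hdist : r - a <= Cmod (z - z0)).
    { pose proof (Cmod_triangle (z - z0) z0) as T.
      replace (z - z0 + z0)%C with z in T by ring; fold a in T; lra. }
    assert (Hdn : (z - z0)%C <> 0) by (apply Cmod_gt_0; lra).
    replace (k z) with (Cconj w * phi z * (z / (z - z0)) - Cconj w * (w * (z / (z - z0))))%C
      by (unfold k; fold w; field; exact Hdn).
    assert (HRe : forall u v : C, Re (u - v) = Re u - Re v)
      by (intros u v; unfold Re; simpl; ring).
    rewrite HRe, Re_Cmult_Cconj_mult.
    pose proof (Re_quotient_ge_half z z0 ltac:(fold a; lra)) as Hhalf.
    (* Expand [|H z - z|^2]; its cross term is [-2 * r ^ 2 * Re (g z)] because [H z = z * g z]. *)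
    assert (Hsq : Cmod (phi z) ^ 2 <= 1 + r ^ 2 - 2 * r ^ 2 * Re (g z)).
    { pose proof (HB z ltac:(lra)) as HBz; pose proof (Cmod_ge_0 (H z)).
      assert (Cmod (H z) ^ 2 <= 1) by nra.
      assert (Hz2 : r ^ 2 * Re (g z) = Re (H z) * Re z + Im (H z) * Im z).
      { rewrite <- Hz.
        replace (H z) with (z * g z)%C
          by (unfold g; field; exact Hzn).
        rewrite Cmod2_alt; unfold Re, Im; simpl; ring. }
      rewrite Cmod2_alt in *.
      assert (r ^ 2 = Re z ^ 2 + Im z ^ 2) by (rewrite <- Hz; apply Cmod2_alt).
      replace (2 * r ^ 2 * Re (g z)) with (2 * (r ^ 2 * Re (g z))) by ring.
      rewrite Hz2.
      replace (Re (phi z)) with (Re (H z) - Re z) by (unfold phi, Re; simpl; ring).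
      replace (Im (phi z)) with (Im (H z) - Im z) by (unfold phi, Im; simpl; ring).
      nra. }
    set (X := 1 + r ^ 2 - 2 * r ^ 2 * Re (g z)) in *.
    (* AM-GM: [2 m <= eta + m ^ 2 / eta] with [m = Cmod (phi z)] *)
    assert (Ham : Cmod (phi z) <= (eta + X / eta) / 2).
    { replace ((eta + X / eta) / 2) with ((eta * eta + X) / (2 * eta)) by (field; lra).
      apply Rle_div_r; [lra|].
      pose proof (pow2_ge_0 (Cmod (phi z) - eta)); lra. }
    assert (Hu : Cmod (z / (z - z0)) <= / (r - a)).
    { rewrite Cmod_div by exact Hdn; unfold Rdiv.
      rewrite <- (Rmult_1_l (/ (r - a))).
      apply Rmult_le_compat; [apply Cmod_ge_0 | | lra | apply Rinv_le_contravar; lra].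
      left; apply Rinv_0_lt_compat; lra. }
    pose proof (Re_le_Cmod (Cconj w * phi z * (z / (z - z0)))) as HR.
    rewrite !Cmod_mult, Cmod_conj in HR.
    assert (HR2 : Cmod w * Cmod (phi z) * Cmod (z / (z - z0))
      <= Cmod w * ((eta + X / eta) / 2) * / (r - a)).
    { apply Rmult_le_compat; try apply Cmod_ge_0; [|apply Rmult_le_compat_l; [apply Cmod_ge_0 | exact Ham] | exact Hu].
      apply Rmult_le_pos; apply Cmod_ge_0. }
    assert (Cmod w ^ 2 * (1 / 2) <= Cmod w ^ 2 * Re (z / (z - z0)))
      by (apply Rmult_le_compat_l; [apply pow2_ge_0 | exact Hhalf]).
    replace (Cmod w / (r - a) * ((eta + X / eta) / 2))
      with (Cmod w * ((eta + X / eta) / 2) * / (r - a)) by (unfold Rdiv; ring).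
    lra. }
  assert (Hint : forall r eta, a < r < 1 -> 0 < eta ->
    Cmod w ^ 2 <= Cmod w / (r - a) * (eta + (1 - r ^ 2) / eta)).
  { intros r eta Hr Heta.
    (* The bound of [Hpoint] regrouped as [A - B * Re (g z)]. Since [Re g] has mean [1] and [k] has
       mean [0], integration gives [0 <= A - B]. *)
    set (A := Cmod w / (r - a) * ((eta + (1 + r ^ 2) / eta) / 2) - Cmod w ^ 2 / 2).
    set (B := Cmod w / (r - a) * (r ^ 2 / eta)).
    assert (Hgi : ex_RInt (fun t => Re (g (polar r t))) 0 (2 * PI)).
    { apply ex_RInt_circle; [lra|]; intros z Hz; apply ex_derive_continuous_C, Hgd; lra. }
    assert (Hki : ex_RInt (fun t => Re (k (polar r t))) 0 (2 * PI)).
    { apply ex_RInt_circle; [lra|]; intros z Hz.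
      apply ex_derive_continuous_C.
      apply (ex_derive_C_mult (fun _ => Cconj w)); [apply ex_derive_const|].
      apply (ex_derive_C_mult (fun w => w)); [apply ex_derive_C_id|].
      apply (ex_derive_C_quotient (fun v => phi v - phi z0)%C).
      - apply ex_derive_C_minus_const, Hphi; lra.
      - intros ->; fold a in Hz; lra. }
    assert (HAB : is_RInt (fun t => A - B * Re (g (polar r t))) 0 (2 * PI)
              ((2 * PI - 0) * A - B * circle_integral g r)).
    { apply (is_RInt_minus (V := R_NormedModule)).
      - apply (is_RInt_const (V := R_NormedModule)).
      - apply (is_RInt_scal (V := R_NormedModule)).
        apply (RInt_correct (V := R_CompleteNormedModule)), Hgi. }
    assert (Hle : circle_integral k r <= (2 * PI - 0) * A - B * circle_integral g r).
    { rewrite <- (is_RInt_unique _ _ _ _ HAB).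
      apply RInt_le; [lra | exact Hki | eexists; exact HAB |].
      intros t _; eapply Rle_trans.
      - apply (Hpoint r eta); [exact Hr | exact Heta | apply Cmod_polar; lra].
      - right; unfold A, B; field; lra. }
    rewrite Hk, Hg in Hle by lra.
    assert (Hle2 : 0 <= A - B) by nra.
    replace (Cmod w / (r - a) * (eta + (1 - r ^ 2) / eta))
      with (2 * (A - B) + Cmod w ^ 2) by (unfold A, B; field; lra).
    lra. }
  assert (Hw0 : Cmod w = 0).
  { apply Rabs_le_all_eps; intros eps Heps.
    rewrite Rabs_pos_eq by apply Cmod_ge_0.
    destruct (Rle_lt_dec (Cmod w) 0) as [Hle|Hpos]; [lra|].
    (* With radius [1 - eta ^ 2 / 2], the quotient [(1 - r ^ 2) / eta] is at most [eta]. The first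
       bound on [eta] keeps [r - a] above [(1 - a) / 2]; the second turns the final estimate
       [4 * eta / (1 - a)] into at most [eps]. *)
    pose (eta := Rmin (1 - a) (eps * (1 - a) / 4)).
    assert (Heta : 0 < eta).
    { apply Rmin_pos; [lra|]; apply Rdiv_lt_0_compat; [apply Rmult_lt_0_compat|]; lra. }
    pose proof (Rmin_l (1 - a) (eps * (1 - a) / 4)) as E1; fold eta in E1.
    pose proof (Rmin_r (1 - a) (eps * (1 - a) / 4)) as E2; fold eta in E2.
    assert (Heta2 : eta ^ 2 <= eta) by nra.
    specialize (Hint (1 - eta ^ 2 / 2) eta).
    assert (0 < eta ^ 2) by (apply pow_lt, Heta).
    assert (Hr : (1 - a) / 2 <= 1 - eta ^ 2 / 2 - a) by lra.
    specialize (Hint ltac:(lra) Heta).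
    assert (Hq : eta + (1 - (1 - eta ^ 2 / 2) ^ 2) / eta <= 2 * eta).
    { apply Rplus_le_reg_l with (- eta).
      replace (- eta + (eta + (1 - (1 - eta ^ 2 / 2) ^ 2) / eta))
        with ((1 - (1 - eta ^ 2 / 2) ^ 2) / eta) by ring.
      apply Rle_div_l; [exact Heta|]; nra. }
    assert (Hd : Cmod w / (1 - eta ^ 2 / 2 - a) <= Cmod w / ((1 - a) / 2)).
    { apply Rmult_le_compat_l; [lra|]; apply Rinv_le_contravar; lra. }
    assert (Hfin : Cmod w ^ 2 <= Cmod w / ((1 - a) / 2) * (2 * eta)).
    { eapply Rle_trans; [exact Hint|].
      apply Rle_trans with (Cmod w / (1 - eta ^ 2 / 2 - a) * (2 * eta)).
      - apply Rmult_le_compat_l; [|exact Hq].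
        left; apply Rdiv_lt_0_compat; lra.
      - apply Rmult_le_compat_r; lra. }
    replace (Cmod w / ((1 - a) / 2) * (2 * eta)) with (Cmod w * (4 * eta / (1 - a))) in Hfin
      by (field; lra).
    replace (Cmod w ^ 2) with (Cmod w * Cmod w) in Hfin by ring.
    apply Rmult_le_reg_l in Hfin; [|exact Hpos].
    eapply Rle_trans; [exact Hfin|].
    apply Rle_div_l; lra. }
  apply Cmod_eq_0 in Hw0.
  replace (H z0) with (phi z0 + z0)%C by (unfold phi; ring).
  fold w; rewrite Hw0; ring.
Qed.

(** * Perturbations of the identity *)

(** The real mean value theorem is applied along the segment to [Re (c * f)] with
    [c = Cconj (f z - f w)], whose total increment is [|f z - f w|^2]; one factor is then
    cancelled. *)
Lemma C_derive_bound_lipschitz (f : C -> C) (M : R) (z w : C) :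
  (forall u, Cmod u < 1 -> ex_derive f u) ->
  (forall u, Cmod u < 1 -> Cmod (C_derive f u) <= M) ->
  Cmod z < 1 -> Cmod w < 1 -> Cmod (f z - f w) <= M * Cmod (z - w).
Proof.
  intros Hf HM Hz Hw.
  set (c := Cconj (f z - f w)); set (h := (z - w)%C).
  pose (p := fun t => (w + t * h)%C).
  assert (Hp : forall t, 0 <= t <= 1 -> Cmod (p t) < 1).
  { intros t Ht; unfold p, h.
    replace (w + t * (z - w))%C with ((1 - t)%R * w + t * z)%C
      by (rewrite RtoC_minus; ring).
    eapply Rle_lt_trans; [apply Cmod_triangle|].
    rewrite !Cmod_mult, !Cmod_R, !Rabs_pos_eq by lra.
    destruct (Req_dec t 0) as [->|Ht0]; [lra | nra]. }
  (* The point [p t] is written in coordinates so that [cauchy_riemann] combines with the chain rule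
     in two real variables. *)
  destruct (MVT_cor2 (fun t => Re (c * f (Re w + t * Re h, Im w + t * Im h)))
    (fun t => Re (c * C_derive f (p t) * h)) 0 1 Rlt_0_1) as [t [Heq Ht]].
  { intros t Ht.
    assert (Hpt : p t = (Re w + t * Re h, Im w + t * Im h)).
    { unfold p, Re, Im; apply injective_projections; simpl; ring. }
    assert (Hd : is_derive (fun u => c * f u)%C (Re w + t * Re h, Im w + t * Im h)
                   (0 * f (p t) + c * C_derive f (p t))%C).
    { rewrite <- Hpt; apply (is_derive_C_mult (fun _ => c)).
      - apply (is_derive_const (K := C_AbsRing) (V := C_NormedModule)).
      - apply C_derive_correct; [exact (RtoC 0)|]; apply Hf, Hp, Ht. }
    destruct (cauchy_riemann _ _ _ _ Hd) as [HRe _].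
    assert (Haff : forall a b, derivable_pt_lim (fun t => a + t * b) t b).
    { intros a b; apply is_derive_Reals; auto_derive; [exact I | ring]. }
    pose proof (derivable_pt_lim_comp_2d _ _ _ _ _ _ _ _ HRe (Haff (Re w) (Re h)) (Haff (Im w) (Im h)))
      as HD.
    evar (l' : R); replace (Re (c * C_derive f (p t) * h)) with l'; [exact HD|].
    unfold l', Re, Im; simpl; ring. }
  assert (Hend : Re (c * f (Re w + 1 * Re h, Im w + 1 * Im h))
               - Re (c * f (Re w + 0 * Re h, Im w + 0 * Im h)) = Cmod (f z - f w) ^ 2).
  { replace (Re w + 1 * Re h, Im w + 1 * Im h) with z
      by (unfold h, Re, Im; apply injective_projections; simpl; ring).
    replace (Re w + 0 * Re h, Im w + 0 * Im h) with w
      by (unfold Re, Im; apply injective_projections; simpl; ring).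
    rewrite Cmod2_alt; unfold c, Re, Im; simpl; ring. }
  rewrite Hend in Heq.
  pose proof (Re_le_Cmod (c * C_derive f (p t) * h)) as HR.
  rewrite !Cmod_mult in HR; unfold c in HR at 2; rewrite Cmod_conj in HR.
  specialize (HM (p t) (Hp t ltac:(lra))).
  pose proof (Cmod_ge_0 h) as Hh; pose proof (Cmod_ge_0 (C_derive f (p t))).
  destruct (Rle_lt_dec (Cmod (f z - f w)) 0) as [Hle|Hpos].
  { apply Rle_trans with 0; [exact Hle|]; apply Rmult_le_pos; lra. }
  apply Rmult_le_reg_l with (Cmod (f z - f w)); [exact Hpos|].
  apply Rle_trans with (Cmod (f z - f w) * Cmod (C_derive f (p t)) * Cmod h); [lra|].
  rewrite Rmult_assoc; apply Rmult_le_compat_l; [lra|].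
  apply Rmult_le_compat_r; lra.
Qed.

(** * Banach fixed points in a closed disc *)

Lemma geometric_increments_converge (x : nat -> R) (K q : R) :
  0 <= q < 1 -> (forall n, Rabs (x (S n) - x n) <= K * q ^ n) ->
  exists l : R, is_lim_seq x l.
Proof.
  intros Hq Hx.
  assert (Hs : ex_series (fun n => x (S n) - x n)).
  { apply (ex_series_le (V := R_CompleteNormedModule) _ (fun n => K * q ^ n)); [exact Hx|].
    apply (ex_series_scal (V := R_NormedModule) K).
    exists (/ (1 - q)); apply is_series_geom; rewrite Rabs_pos_eq; lra. }
  destruct Hs as [s Hs]; exists (s + x 0%nat).
  apply is_lim_seq_incr_1.
  apply is_lim_seq_ext with (fun n => sum_n (fun k => x (S k) - x k) n + x 0%nat).
  - intros n; induction n as [|n IH].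
    + rewrite sum_O; ring.
    + rewrite sum_Sn; unfold plus; simpl; lra.
  - apply (is_lim_seq_plus' _ _ s (x 0%nat)); [exact Hs | apply is_lim_seq_const].
Qed.

(** The iterates from [0] have geometrically small increments, so both coordinates converge; the
    limit stays in the closed disc and is fixed because [T] is Lipschitz. *)
Lemma contraction_fixed_point (T : C -> C) (r q : R) :
  0 <= r -> 0 <= q < 1 ->
  (forall z, Cmod z <= r -> Cmod (T z) <= r) ->
  (forall z w, Cmod z <= r -> Cmod w <= r -> Cmod (T z - T w) <= q * Cmod (z - w)) ->
  exists z, Cmod z <= r /\ T z = z.
Proof.
  intros Hr Hq Hself Hlip.
  pose (u := fix u n := match n with O => RtoC 0 | S k => T (u k) end).
  assert (Hu : forall n, Cmod (u n) <= r).
  { intros n; induction n as [|n IH]; simpl; [rewrite Cmod_0; exact Hr | apply Hself, IH]. }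
  assert (Hinc : forall n, Cmod (u (S n) - u n) <= Cmod (u 1%nat - u 0%nat) * q ^ n).
  { intros n; induction n as [|n IH]; [simpl; lra|].
    eapply Rle_trans; [apply (Hlip (u (S n)) (u n)); apply Hu|].
    simpl pow; apply (Rmult_le_compat_l q) in IH; lra. }
  destruct (geometric_increments_converge (fun n => Re (u n)) (Cmod (u 1%nat - u 0%nat)) q Hq) as [x Hx].
  { intros n; eapply Rle_trans; [|apply Hinc].
    refine (Rle_trans _ _ _ _ (re_le_Cmod _)); right; reflexivity. }
  destruct (geometric_increments_converge (fun n => Im (u n)) (Cmod (u 1%nat - u 0%nat)) q Hq) as [y Hy].
  { intros n; eapply Rle_trans; [|apply Hinc].
    refine (Rle_trans _ _ _ _ (Im_abs_le_Cmod _)); right; reflexivity. }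
  pose (z := (x, y) : C).
  assert (Hlim : forall eps, 0 < eps -> exists N, forall n, (N <= n)%nat -> Cmod (u n - z) <= eps).
  { intros eps Heps.
    apply is_lim_seq_spec in Hx; apply is_lim_seq_spec in Hy.
    assert (He : 0 < eps / 2) by lra.
    destruct (Hx (mkposreal _ He)) as [N1 H1]; destruct (Hy (mkposreal _ He)) as [N2 H2].
    exists (Nat.max N1 N2); intros n Hn.
    specialize (H1 n ltac:(lia)); specialize (H2 n ltac:(lia)); simpl in H1, H2.
    eapply Rle_trans; [apply Cmod_le_Rabs|].
    change (Re (u n - z)) with (Re (u n) - x); change (Im (u n - z)) with (Im (u n) - y); lra. }
  assert (Hz : Cmod z <= r).
  { apply le_epsilon; intros eps Heps; destruct (Hlim eps Heps) as [N HN].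
    specialize (HN N (Nat.le_refl N)).
    pose proof (Cmod_triangle (u N) (- (u N - z))) as HT; rewrite Cmod_opp in HT.
    replace (u N + - (u N - z))%C with z in HT by ring; specialize (Hu N); lra. }
  exists z; split; [exact Hz|].
  assert (H0 : Cmod (T z - z) = 0).
  { apply Rabs_le_all_eps; intros eps Heps; rewrite Rabs_pos_eq by apply Cmod_ge_0.
    destruct (Hlim (eps / 2) ltac:(lra)) as [N HN].
    pose proof (HN N ltac:(lia)) as HN1; pose proof (HN (S N) ltac:(lia)) as HN2.
    pose proof (Hlip (u N) z (Hu N) Hz) as HL.
    pose proof (Cmod_triangle (- (T (u N) - T z)) (u (S N) - z)) as HT; rewrite Cmod_opp in HT.
    replace (- (T (u N) - T z) + (u (S N) - z))%C with (T z - z)%C in HT by (simpl; ring).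
    assert (q * Cmod (u N - z) <= 1 * Cmod (u N - z))
      by (apply Rmult_le_compat_r; [apply Cmod_ge_0 | lra]).
    lra. }
  apply Cmod_eq_0 in H0; replace (T z) with (T z - z + z)%C by ring; rewrite H0; ring.
Qed.

(** * Injectivity and image on the disc of radius [rho2] *)

Lemma rho2_bounds (Lam : R) :
  0 <= Lam -> 0 < rho2 Lam <= 1 /\ 2 * Lam * rho2 Lam <= 1.
Proof.
  intros HL; unfold rho2; destruct (Rle_dec Lam (1 / 2)) as [H|H]; [lra|].
  assert (H2 : 1 < 2 * Lam) by lra.
  split; [split|].
  - apply Rdiv_lt_0_compat; lra.
  - apply Rle_div_l; lra.
  - right; field; lra.
Qed.

(** Split the difference as [Cconj z * (G z - G w) + Cconj (z - w) * (G w - G 0)] and apply the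
    Lipschitz bound to each term. *)
Lemma Cconj_mult_lipschitz (G : C -> C) (Lam : R) (z w : C) :
  (forall u v, Cmod u < 1 -> Cmod v < 1 -> Cmod (G u - G v) <= Lam * Cmod (u - v)) ->
  G 0 = 0 -> Cmod z < 1 -> Cmod w < 1 ->
  Cmod (Cconj z * G z - Cconj w * G w) <= Lam * (Cmod z + Cmod w) * Cmod (z - w).
Proof.
  intros HG G0 Hz Hw.
  replace (Cconj z * G z - Cconj w * G w)%C
    with (Cconj z * (G z - G w) + Cconj (z - w) * (G w - G 0))%C.
  2: { rewrite Cminus_conj, G0; ring. }
  eapply Rle_trans; [apply Cmod_triangle|].
  rewrite !Cmod_mult, !Cmod_conj.
  pose proof (HG z w Hz Hw) as H1.
  pose proof (HG w 0 Hw ltac:(rewrite Cmod_0; lra)) as H2.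
  replace (w - 0)%C with w in H2 by ring.
  apply (Rmult_le_compat_l (Cmod z)) in H1; [|apply Cmod_ge_0].
  apply (Rmult_le_compat_l (Cmod (z - w))) in H2; [|apply Cmod_ge_0].
  lra.
Qed.

Lemma univalent_perturbed_identity (G : C -> C) (Lam : R) :
  0 <= Lam ->
  (forall u v, Cmod u < 1 -> Cmod v < 1 -> Cmod (G u - G v) <= Lam * Cmod (u - v)) ->
  G 0 = 0 -> univalent_on_disc (fun z => Cconj z * G z + z)%C (rho2 Lam).
Proof.
  intros HL HG G0 z w Hz Hw E; unfold in_disc in *.
  destruct (rho2_bounds Lam HL) as [Hrho HLrho].
  pose proof (Cconj_mult_lipschitz G Lam z w HG G0 ltac:(lra) ltac:(lra)) as Hlip.
  replace (Cconj z * G z - Cconj w * G w)%C with (- (z - w))%C in Hlip.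
  2: { replace (Cconj z * G z)%C with (Cconj z * G z + z - z)%C by ring; rewrite E; ring. }
  rewrite Cmod_opp in Hlip.
  destruct (Ceq_dec z w) as [|Hzw]; [assumption|].
  apply Cminus_neq_0, Cmod_gt_0 in Hzw.
  assert (H1 : Lam * (Cmod z + Cmod w) < 1).
  { destruct (Req_dec Lam 0) as [->|HL0]; [lra|].
    assert (Lam * (Cmod z + Cmod w) < Lam * (2 * rho2 Lam))
      by (apply Rmult_lt_compat_l; lra).
    lra. }
  apply (Rmult_lt_compat_r (Cmod (z - w))) in H1; lra.
Qed.

Lemma image_perturbed_identity (G : C -> C) (Lam : R) :
  0 <= Lam ->
  (forall u v, Cmod u < 1 -> Cmod v < 1 -> Cmod (G u - G v) <= Lam * Cmod (u - v)) ->
  G 0 = 0 ->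
  image_contains_disc (fun z => Cconj z * G z + z)%C (rho2 Lam) (sigma2 Lam).
Proof.
  intros HL HG G0 w Hw; unfold in_disc, sigma2 in *.
  destruct (rho2_bounds Lam HL) as [Hrho HLrho].
  set (rho := rho2 Lam) in *.
  (* The contraction constant [2 * Lam * r] must be below [1], so the disc is shrunk to radius
     [r = rho - d]. This lowers [r - Lam * r ^ 2] by at most [d * (1 + Lam)], hence not below
     [Cmod w]. *)
  pose (d := Rmin (rho / 2) ((rho - Lam * rho ^ 2 - Cmod w) / (1 + Lam))).
  assert (Hd : 0 < d).
  { apply Rmin_pos; [lra|]; apply Rdiv_lt_0_compat; lra. }
  pose proof (Rmin_l (rho / 2) ((rho - Lam * rho ^ 2 - Cmod w) / (1 + Lam))) as Hd1.
  pose proof (Rmin_r (rho / 2) ((rho - Lam * rho ^ 2 - Cmod w) / (1 + Lam))) as Hd2.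
  fold d in Hd1, Hd2.
  apply Rle_div_r in Hd2; [|lra].
  set (r := rho - d).
  assert (Hr : 0 < r < rho) by (unfold r; lra).
  assert (Hwr : Cmod w + Lam * r ^ 2 <= r).
  { assert (Lam * d ^ 2 <= Lam * d) by (apply Rmult_le_compat_l; nra).
    assert (2 * Lam * rho * d <= 1 * d) by (apply Rmult_le_compat_r; lra).
    assert (0 <= Lam * rho * d) by (repeat apply Rmult_le_pos; lra).
    unfold r; nra. }
  assert (Hq : 2 * Lam * r < 1).
  { destruct (Req_dec Lam 0) as [->|HL0]; [lra|].
    assert (2 * Lam * r < 2 * Lam * rho) by (apply Rmult_lt_compat_l; lra); lra. }
  destruct (contraction_fixed_point (fun z => w - Cconj z * G z)%C r (2 * Lam * r))
    as [z [Hz Ez]].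
  - lra.
  - split; [repeat apply Rmult_le_pos; lra | exact Hq].
  - intros z Hz.
    pose proof (Cconj_mult_lipschitz G Lam z 0 HG G0 ltac:(lra) ltac:(rewrite Cmod_0; lra)) as H1.
    replace (Cconj z * G z - Cconj 0 * G 0)%C with (Cconj z * G z)%C in H1 by (rewrite G0; ring).
    replace (z - 0)%C with z in H1 by ring; rewrite Cmod_0 in H1.
    pose proof (Cmod_triangle w (- (Cconj z * G z))) as HT; rewrite Cmod_opp in HT.
    pose proof (Cmod_ge_0 z).
    assert (Lam * (Cmod z + 0) * Cmod z <= Lam * r ^ 2).
    { rewrite Rmult_assoc; apply Rmult_le_compat_l; [exact HL|]; nra. }
    unfold Cminus; lra.
  - intros z v Hz Hv.
    pose proof (Cconj_mult_lipschitz G Lam z v HG G0 ltac:(lra) ltac:(lra)) as H1.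
    replace (w - Cconj z * G z - (w - Cconj v * G v))%C
      with (- (Cconj z * G z - Cconj v * G v))%C by ring.
    rewrite Cmod_opp; eapply Rle_trans; [exact H1|].
    apply Rmult_le_compat_r; [apply Cmod_ge_0|].
    replace (2 * Lam * r) with (Lam * (r + r)) by ring.
    apply Rmult_le_compat_l; lra.
  - exists z; split; [lra|].
    rewrite <- Ez at 3; ring.
Qed.

(** * The extremal function on the real axis, and the final assembly *)

Lemma F2_real (Lam x : R) : F2 Lam x = RtoC (Lam * x ^ 2 + x).
Proof.
  unfold F2; rewrite Cmod_R, <- !Rsqr_pow2, <- Rsqr_abs, RtoC_plus; reflexivity.
Qed.

Theorem theorem2p2 (Lam : R) (HLam : 0 <= Lam) :
  (forall G H : C -> C,
     analytic_on_unit_disc G -> analytic_on_unit_disc H ->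
     G (RtoC 0) = RtoC 0 -> H (RtoC 0) = RtoC 0 ->
     is_derive H (RtoC 0) (RtoC 1) ->
     (forall z : C, in_disc 1 z -> Cmod (C_derive G z) <= Lam) ->
     ((forall z : C, in_disc 1 z -> Cmod (H z) < 1) \/
      (forall z : C, in_disc 1 z -> Cmod (C_derive H z) <= 1)) ->
     let F := fun z : C => Cplus (Cmult (Cconj z) (G z)) (H z) in
     univalent_on_disc F (rho2 Lam) /\ image_contains_disc F (rho2 Lam) (sigma2 Lam))
  /\
  (* sharpness via F_2(z) = Lam |z|^2 + z = conj(z) * (Lam z) + z *)
  (forall z : C, F2 Lam z = Cplus (Cmult (Cconj z) (Cmult (RtoC Lam) z)) z)
  /\ (forall r : R, rho2 Lam < r <= 1 -> ~ univalent_on_disc (F2 Lam) r)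
  /\ (forall s : R, sigma2 Lam < s -> ~ image_contains_disc (F2 Lam) (rho2 Lam) s).
Proof.
  destruct (rho2_bounds Lam HLam) as [Hrho HLrho].
  split; [|split; [|split]].
  - intros G H HG HH G0 H0 HD0 HG' HHbound F.
    assert (HB : forall z, Cmod z < 1 -> Cmod (H z) < 1).
    { destruct HHbound as [HB|HB]; [exact HB|]; intros z Hz.
      pose proof (C_derive_bound_lipschitz H 1 z 0 HH HB Hz ltac:(rewrite Cmod_0; lra)) as HL.
      rewrite H0 in HL; replace (H z - 0)%C with (H z) in HL by ring.
      replace (z - 0)%C with z in HL by ring; lra. }
    pose proof (schwarz_rigidity H HH H0 HD0 HB) as Hid.
    assert (HL : forall u v, Cmod u < 1 -> Cmod v < 1 -> Cmod (G u - G v) <= Lam * Cmod (u - v))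
      by (intros u v; apply C_derive_bound_lipschitz; assumption).
    assert (HF : forall z, Cmod z < rho2 Lam -> F z = (Cconj z * G z + z)%C).
    { intros z Hz; unfold F; rewrite Hid by lra; reflexivity. }
    split.
    + intros z w Hz Hw E; rewrite !HF in E by assumption.
      exact (univalent_perturbed_identity G Lam HLam HL G0 z w Hz Hw E).
    + intros w Hw.
      destruct (image_perturbed_identity G Lam HLam HL G0 w Hw) as [z [Hz E]].
      exists z; split; [exact Hz|]; rewrite HF; assumption.
  - intros z; unfold F2; rewrite RtoC_mult, Cmod2_conj; ring.
  - intros r Hr Huniv.
    unfold rho2 in *; destruct (Rle_dec Lam (1 / 2)) as [HL|HL]; [lra|].
    set (rho := 1 / (2 * Lam)) in *.
    (* The parabola [Lam * x ^ 2 + x] has its vertex at [- rho], so [- rho + e] and [- rho - e]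
       share their image; [e < r - rho] keeps both in the disc. *)
    pose (e := Rmin rho (r - rho) / 2).
    pose proof (Rmin_l rho (r - rho)); pose proof (Rmin_r rho (r - rho)).
    assert (0 < Rmin rho (r - rho)) by (apply Rmin_pos; lra).
    assert (E : RtoC (- rho + e) = RtoC (- rho - e)).
    { apply Huniv; unfold in_disc; rewrite ?Cmod_R.
      - unfold e; apply Rabs_def1; lra.
      - unfold e; apply Rabs_def1; lra.
      - rewrite !F2_real; f_equal; unfold rho; field; lra. }
    apply RtoC_inj in E; unfold e in E; lra.
  - intros s Hs Him; unfold sigma2 in Hs; set (rho := rho2 Lam) in *.
    assert (Hsig : 0 <= rho - Lam * rho ^ 2) by nra.
    (* The omitted value is [F2 Lam (- rho)], the image of a boundary point, of modulus
       [sigma2 Lam < s]. *)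
    destruct (Him (RtoC (- (rho - Lam * rho ^ 2)))) as [z [Hz E]].
    { unfold in_disc; rewrite Cmod_R, Rabs_Ropp, Rabs_pos_eq by exact Hsig; exact Hs. }
    destruct z as [x y].
    (* [F2] preserves imaginary parts, so a preimage of a real number is real. *)
    assert (Hy : y = 0) by (apply (f_equal snd) in E; simpl in E; lra).
    subst y; change ((x, 0) : C) with (RtoC x) in *.
    rewrite F2_real in E; apply RtoC_inj in E.
    unfold in_disc in Hz; rewrite Cmod_R in Hz; apply Rabs_def2 in Hz.
    (* The root [- rho] is outside the open disc, and for [x > - rho] the second factor is positive
       since [2 * Lam * rho <= 1]. *)
    assert (Hfac : (x + rho) * (Lam * (x - rho) + 1) = 0) by lra.
    apply Rmult_integral in Hfac; destruct Hfac as [Hf|Hf]; [lra|].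
    destruct (Req_dec Lam 0) as [->|HL0]; [lra|].
    assert (Lam * (- (2 * rho)) < Lam * (x - rho)) by (apply Rmult_lt_compat_l; lra).
    lra.
Qed.
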